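(* Let $n\ge1$, $0\le k\le n-1$ and $i>0$ be integers. The following four sets have the same cardinality: (1) the set of $(\alpha_0,\rho)\in\mathcal S_{n,k+1}$ with $\mathsf{des}((\alpha_0,\rho))=i$; (2) the set of $\sigma\in\mathcal S_n$ with $\mathsf{des}(\sigma)=i$ whose special reverse wave $\mathsf{srw}(\sigma)$ has length at least $n-k$; (3) the set of $\sigma\in\mathcal S_n$ with $\mathsf{des}(\sigma)=i$ whose special wave $\mathsf{sw}(\sigma)$ has length at least $n-k$; (4) the set of $\sigma\in\mathcal S_n$ with $\mathsf{lec}(\sigma)=i$ whose rightmost hook has length at least $n-k$.
   Context: $[n]=\{1,\dots,n\}$. $\mathcal S_{n,k+1}$ is the set of pairs $(\alpha_0,\rho)$ with $\rho=\rho_1\cdots\rho_{k+1}$ a word of $k+1$ distinct elements of $[n]$ and $\alpha_0=[n]\setminus\{\rho_1,\dots,\rho_{k+1}\}$; $\mathsf{des}((\alpha_0,\rho))=\#\{j\in[k]:\rho_j>\rho_{j+1}\}+\#\{a\in\alpha_0:a>\rho_1\}$. Permutations are words $\sigma_1\cdots\sigma_n$; for a word $u=u_1\cdots u_\ell$, $\mathsf{des}(u)=\#\{j\in[\ell-1]:u_j>u_{j+1}\}$ and $\mathsf{inv}(u)=\#\{(p,q):p<q,\ u_p>u_q\}$. For a nonempty word $w=w_1\cdots w_\ell$ with distinct positive entries: if $w$ is increasing, $\mathsf{srw}(w)=\mathsf{sw}(w)=w$. Otherwise let $t$ be minimal with $w_t>w_{t+1}$ and set $w_0=0$. Special reverse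 wave: with $s$ maximal such that $t\le s\le\ell$ and $w_t>w_{t+1}>\cdots>w_s>w_{t-1}$, $\mathsf{srw}(w)=w_1\cdots w_s$. Special wave: with $r$ minimal such that $1\le r\le t$ and $w_r>w_{t+1}$, and $s'$ maximal such that $t<s'\le\ell$ and $w_{t+1}>\cdots>w_{s'}>w_{r-1}$, $\mathsf{sw}(w)=w_r\cdots w_{s'}$. Hook factorization: $w=\gamma*\alpha_1*\cdots*\alpha_m$ uniquely, with $\gamma$ a possibly empty increasing word and each $\alpha_j=a_1\cdots a_r$ a hook ($r\ge2$, $a_1>a_2$, $a_2<\cdots<a_r$); $\mathsf{lec}(w)=\sum_j\mathsf{inv}(\alpha_j)$. The rightmost hook of $w$ is $\alpha_m$ if $m\ge1$, and $w$ itself if $m=0$. *)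

(* Defs.v *)
From mathcomp Require Import all_boot all_fingroup.

Set Implicit Arguments.
Unset Strict Implicit.
Unset Printing Implicit Defensive.

(* Words are sequences of positive naturals, with 1-based letters
   w_1, ..., w_(size w) and the convention w_0 = 0. *)
Definition letter (w : seq nat) (j : nat) : nat := nth 0 (0 :: w) j.

Definition increasing (w : seq nat) : bool := sorted ltn w.

Definition desc_at (w : seq nat) (j : nat) : bool :=
  letter w j > letter w j.+1.

(* The positions j in [l - 1] with w_j > w_(j+1), where l = size w. *)
Definition descents (w : seq nat) : seq nat :=
  [seq j <- iota 1 (size w).-1 | desc_at w j].

Definition des (w : seq nat) : nat := size (descents w).

Definition inv (w : seq nat) : nat :=
  count (fun pq : nat * nat =>
           (pq.1 < pq.2) && (letter w pq.1 > letter w pq.2))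
        [seq (p, q) | p <- iota 1 (size w), q <- iota 1 (size w)].

(* w_a ... w_b *)
Definition factor (w : seq nat) (a b : nat) : seq nat := drop a.-1 (take b w).

(* w_a > w_(a+1) > ... > w_b *)
Definition decreasing_on (w : seq nat) (a b : nat) : bool :=
  all (desc_at w) (iota a (b - a)).

(* Smallest, resp. largest, j with a <= j <= b and P j; both are used only
   where such a j exists, the default values being irrelevant. *)
Definition min_in (a b : nat) (P : pred nat) : nat :=
  head 0 [seq j <- iota a (b.+1 - a) | P j].
Definition max_in (a b : nat) (P : pred nat) : nat :=
  last 0 [seq j <- iota a (b.+1 - a) | P j].

Definition first_descent (w : seq nat) : nat := head 0 (descents w).

Definition srw (w : seq nat) : seq nat :=
  if increasing w then w else
  let t := first_descent w in
  let s := max_in t (size w) (fun s =>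
             decreasing_on w t s && (letter w s > letter w t.-1)) in
  factor w 1 s.

Definition sw (w : seq nat) : seq nat :=
  if increasing w then w else
  let t := first_descent w in
  let r := min_in 1 t (fun r => letter w r > letter w t.+1) in
  let s := max_in t.+1 (size w) (fun s =>
             decreasing_on w t.+1 s && (letter w s > letter w r.-1)) in
  factor w r s.

Definition is_hook (a : seq nat) : bool :=
  if a is a1 :: a2 :: b then (a1 > a2) && increasing (a2 :: b) else false.

Definition is_hook_factorization
    (w : seq nat) (f : seq nat * seq (seq nat)) : bool :=
  [&& w == f.1 ++ flatten f.2, increasing f.1 & all is_hook f.2].

(* The hook factorization (gamma, [:: alpha_1; ...; alpha_m]), computed from
   right to left; the two lemmas below show that it is the unique hook
   factorization of a word with distinct letters. *)
Fixpoint hook_factorization (w : seq nat) : seq nat * seq (seq nat) :=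
  if w is x :: w' then
    let: (g, hs) := hook_factorization w' in
    if g is y :: _ then
      if x > y then ([::], (x :: g) :: hs) else (x :: g, hs)
    else ([:: x], hs)
  else ([::], [::]).

Lemma hook_factorizationP (w : seq nat) :
  uniq w -> is_hook_factorization w (hook_factorization w).
Proof.
elim: w => [//|x w IHw] /= /andP[xNw /IHw].
case: (hook_factorization w) => [[|y g] hs] /and3P[/= /eqP Dw inc_g hook_hs].
  by rewrite /is_hook_factorization /= Dw eqxx.
have neq_xy : x != y.
  by apply: contraNneq xNw => ->; rewrite Dw mem_head.
rewrite /is_hook_factorization; case: (ltnP y x) => [lt_yx|le_xy] /=.
  by rewrite Dw eqxx lt_yx /= hook_hs andbT.
rewrite Dw eqxx hook_hs andbT /= ltn_neqAle neq_xy le_xy.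
exact: inc_g.
Qed.

Lemma hook_factorization_uniq (w : seq nat) (f : seq nat * seq (seq nat)) :
  is_hook_factorization w f -> f = hook_factorization w.
Proof.
elim: w f => [|x w IHw] [g hs] /and3P[/= /eqP Dw inc_g hook_hs].
  by case: g hs Dw inc_g hook_hs => [|//] [//|[|a h] hs].
case: g Dw inc_g => [|x' g] /=.
  case: hs hook_hs => [//|[|a [|b h]] hs] //= /andP[/andP[lt_ba inc_h] hook_hs].
  case=> -> Dw _.
  by rewrite -(IHw (b :: h, hs)) /= ?lt_ba // /is_hook_factorization /= Dw eqxx inc_h.
case=> <- Dw inc_xg.
rewrite -(IHw (g, hs)).
  by case: g inc_xg {Dw} => [//|y g] /= /andP[/ltnW le_xy _]; rewrite ltnNge le_xy.
by rewrite /is_hook_factorization /increasing /= Dw eqxx hook_hs (path_sorted inc_xg).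
Qed.

Definition lec (w : seq nat) : nat :=
  sumn [seq inv a | a <- (hook_factorization w).2].

Definition rightmost_hook (w : seq nat) : seq nat :=
  last w (hook_factorization w).2.

(* [n] is represented by 'I_n, with a : 'I_n standing for a + 1; permutations
   of [n] become words in the letters 1, ..., n. *)
Definition word_of_perm (n : nat) (s : 'S_n) : seq nat :=
  [seq (val (s j)).+1 | j <- enum 'I_n].

(* The set S_(n,m) of pairs (alpha_0, rho), rho being of length m. *)
Definition partial_words (n m : nat) : {set {set 'I_n} * m.-tuple 'I_n} :=
  [set x : {set 'I_n} * m.-tuple 'I_n | uniq x.2 & x.1 == [set a | a \notin x.2]].

Definition des_pair (n k : nat) (x : {set 'I_n} * k.+1.-tuple 'I_n) : nat :=
  des [seq (val a).+1 | a <- x.2] + #|[set a in x.1 | a > thead x.2]|.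

(* Main.v *)
Require Import Defs.
From mathcomp Require Import all_boot all_fingroup.
From mathcomp Require Import zify.

Set Implicit Arguments.
Unset Strict Implicit.
Unset Printing Implicit Defensive.

(** A non-increasing word [w] with hook factorization [g * h_1 * ... * h_m] is the
    same as the prefix [v = g * h_1 * ... * h_(m-1)], the set [b] of letters of
    [h_m] and the number [j = inv h_m] with [1 <= j < #|b|]; here
    [lec w = lec v + j].  Given such a triple [(b, v, j)] there is also exactly one
    way to insert the letters of [b] into [v] so that they form the special wave
    (resp. the special reverse wave) of the resulting word and the number of
    descents grows by [j].  Iterating over the hooks gives an injection, hence a
    bijection, of the permutations onto themselves that carries [lec] to [des] and
    the length of the rightmost hook to the length of the wave.

    For the pairs [(alpha_0, rho)]: the special reverse wave of [w] has length at
    least [m] iff the prefix of length [m] is [p1 ++ rev p2] with [p1 ++ p2]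
    increasing.  Such a prefix is determined by its set of letters and its last
    letter [rho_1], and its number of descents is that of the [a] in [alpha_0] with
    [a > rho_1]. *)

(* [all_fingroup] shadows the name with the inverse of a group. *)
Local Notation inv := Defs.inv.

(** * Letters of concatenations, extremal positions and the first descent *)

Lemma letter_cat (u v : seq nat) (j : nat) :
  letter (u ++ v) j = if j <= size u then letter u j else letter v (j - size u).
Proof.
case: j => [//|j]; rewrite /letter /= nth_cat; case: ltnP => // le_uj.
by rewrite subSn.
Qed.

Lemma letter_catl (u v : seq nat) (j : nat) :
  j <= size u -> letter (u ++ v) j = letter u j.
Proof. by rewrite letter_cat => ->. Qed.

Lemma letter_catr (u v : seq nat) (j : nat) :
  letter (u ++ v) (size u + j.+1) = nth 0 v j.
Proof. by rewrite letter_cat ifN; [rewrite addKn | lia]. Qed.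

Lemma letter_size (u : seq nat) : letter u (size u) = last 0 u.
Proof. by rewrite /letter -nth_last; case: u => //= x u; lia. Qed.

Lemma letter_rev (u : seq nat) (j : nat) :
  0 < j <= size u -> letter (rev u) j = nth 0 u (size u - j).
Proof. by case: j => // j /andP[_ ltju]; rewrite /letter /= nth_rev. Qed.

Lemma min_in_eq (a b m : nat) (P : pred nat) :
  a <= m <= b -> P m -> (forall j, a <= j < m -> ~~ P j) -> min_in a b P = m.
Proof.
move=> /andP[le_am le_mb] Pm NP; rewrite /min_in.
have -> : b.+1 - a = (m - a) + (b - m).+1 by lia.
rewrite iotaD filter_cat subnKC //= Pm.
rewrite (eq_in_filter (a2 := pred0)) ?filter_pred0 // => j.
rewrite mem_iota subnKC // => /NP; exact: negbTE.
Qed.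

Lemma max_in_eq (a b m : nat) (P : pred nat) :
  a <= m <= b -> P m -> (forall j, m < j <= b -> ~~ P j) -> max_in a b P = m.
Proof.
move=> /andP[le_am le_mb] Pm NP; rewrite /max_in.
have -> : b.+1 - a = (m - a) + (b - m).+1 by lia.
rewrite iotaD filter_cat subnKC //= Pm.
rewrite (eq_in_filter (a1 := P) (a2 := pred0) (s := iota m.+1 _)).
  by rewrite filter_pred0 last_cat.
move=> j; rewrite mem_iota => jb; apply: negbTE; apply: NP; lia.
Qed.

Lemma max_inP (a b j : nat) (P : pred nat) :
  a <= j <= b -> P j ->
  [/\ a <= max_in a b P, j <= max_in a b P, max_in a b P <= b & P (max_in a b P)].
Proof.
move=> ajb Pj.
have exP : exists m, (a <= m <= b) && P m by exists j; rewrite ajb.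
have bP m : (a <= m <= b) && P m -> m <= b by lia.
case: (ex_maxnP exP bP) => m /andP[amb Pm] max_m.
rewrite (max_in_eq (m := m)) //; first by split=> //; [lia | apply: max_m; rewrite ajb | lia].
move=> i mib; apply: contraL (mib) => Pi.
have /max_m : (a <= i <= b) && P i by rewrite Pi; lia.
lia.
Qed.

Lemma first_descent_eq (w : seq nat) (t : nat) :
  0 < t < size w -> desc_at w t -> (forall j, 0 < j < t -> ~~ desc_at w j) ->
  first_descent w = t.
Proof.
move=> tw dt Nd; rewrite /first_descent -(@min_in_eq 1 (size w).-1 t (desc_at w)) //.
  by rewrite /min_in subn1.
lia.
Qed.

Lemma increasingP (w : seq nat) :
  reflect (forall j, 0 < j < size w -> letter w j < letter w j.+1) (increasing w).
Proof.
apply: (iffP (sortedP 0)) => incw j jw; last exact: (incw j.+1).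
by case: j jw => // j /andP[_ /incw].
Qed.

(** [path ltn 0 w] encodes an increasing word with positive letters; by the convention [w_0 = 0] the
    index [i] may also be 0. *)
Lemma ltn_letter_path (w : seq nat) (i j : nat) :
  path ltn 0 w -> i < j <= size w -> letter w i < letter w j.
Proof.
move=> incw /andP[lt_ij le_jw]; rewrite /letter.
have /(sorted_ltn_nth ltn_trans 0) : sorted ltn (0 :: w) by [].
by apply=> //; rewrite inE /=; lia.
Qed.

Lemma first_descentP (w : seq nat) : uniq w -> ~~ increasing w ->
  [/\ 0 < first_descent w < size w, desc_at w (first_descent w) &
      forall j, 0 < j < first_descent w -> letter w j < letter w j.+1].
Proof.
move=> Uw Nincw.
have Nd j : 0 < j < size w -> ~~ desc_at w j -> letter w j < letter w j.+1.
  case: j => // j jw; rewrite /desc_at -leqNgt ltn_neqAle => le_j.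
  rewrite le_j andbT; change (nth 0 w j != nth 0 w j.+1).
  case/andP: jw => _ jw; rewrite nth_uniq ?(ltnW jw) //; lia.
have exd : exists j, (0 < j < size w) && desc_at w j.
  have [/hasP[j]|/hasPn noD] := boolP (has (desc_at w) (iota 1 (size w).-1)).
    by rewrite mem_iota => jw dj; exists j; rewrite dj; lia.
  case/increasingP: Nincw => j jw; apply: Nd => //; apply: noD.
  by rewrite mem_iota; lia.
case: (ex_minnP exd) => t /andP[tw dt] min_t.
have Ndt j : 0 < j < t -> ~~ desc_at w j.
  move=> jt; apply: contraL (jt) => dj.
  have /min_t : (0 < j < size w) && desc_at w j by rewrite dj; lia.
  lia.
rewrite (first_descent_eq tw dt Ndt); split=> // j jt.
by apply: Nd (Ndt _ jt); lia.
Qed.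

Lemma decreasing_onP (w : seq nat) (a b : nat) :
  reflect (forall j, a <= j < b -> letter w j.+1 < letter w j) (decreasing_on w a b).
Proof.
apply: (iffP allP) => dec j; last by rewrite mem_iota => ?; apply: dec; lia.
by move=> jab; apply: dec; rewrite mem_iota; lia.
Qed.

Lemma decreasing_on_leq (w : seq nat) (a b i j : nat) :
  decreasing_on w a b -> a <= i -> i <= j <= b -> letter w j <= letter w i.
Proof.
move=> /decreasing_onP dec le_ai.
elim: j => [|j IHj] /andP[le_ij le_jb]; first by have -> : i = 0 by lia.
have [->//|lt_ij] := eqVneq i j.+1.
by have := dec j; have := IHj; lia.
Qed.


(** * Descents of concatenations *)

Lemma des_cons2 (x y : nat) (s : seq nat) :
  des [:: x, y & s] = (y < x) + des (y :: s).
Proof.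
rewrite /des /descents !size_filter /=; congr (_ + _).
rewrite (iotaDl 1 1) count_map; apply: eq_in_count => -[|j] //.
by rewrite mem_iota.
Qed.

(** For empty [u] the default value 0 of [last] makes the junction term vanish. *)
Lemma des_cat (u v : seq nat) (x : nat) :
  des (u ++ x :: v) = des u + (x < last 0 u) + des (x :: v).
Proof.
elim: u => [|y [|z u] IHu] //; first exact: des_cons2.
by rewrite [LHS]des_cons2 IHu des_cons2 /= !addnA.
Qed.

Lemma des_increasing (w : seq nat) : increasing w -> des w = 0.
Proof.
elim: w => [|x [|y w] IHw] // /andP[lt_xy /IHw IH].
by rewrite des_cons2 IH; lia.
Qed.

Lemma des_rev_increasing (w : seq nat) : increasing w -> des (rev w) = (size w).-1.
Proof.
elim: w => [|x [|y w] IHw] // /andP[lt_xy /IHw IH].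
rewrite rev_cons -cats1 des_cat IH rev_cons last_rcons /=.
by have -> : x < y by []; rewrite addn0 addn1.
Qed.

(** * Recognizing the two waves inside a concatenation *)

Lemma letter_wavel (p1 p2 v : seq nat) (j : nat) :
  j <= size p1 -> letter (p1 ++ rev p2 ++ v) j = letter (p1 ++ p2) j.
Proof. by move=> jp; rewrite !letter_catl. Qed.

(** Reflecting positions in the reversed block reads every letter of the wave off the increasing
    word [p1 ++ p2], so that comparing letters becomes comparing positions. *)
Lemma letter_waver (p1 p2 v : seq nat) (j : nat) :
  size p1 < j <= size p1 + size p2 ->
  letter (p1 ++ rev p2 ++ v) j =
  letter (p1 ++ p2) (size p1 + (size p2 - (j - size p1)).+1).
Proof.
move=> jp; rewrite letter_cat ifN; last lia.
by rewrite letter_catl ?letter_rev ?letter_catr ?size_rev; lia.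
Qed.

(** The first disjunction puts the first descent at the peak, position [size p1 + 1]; the last
    hypothesis prevents the first letter of [v] from prolonging the decreasing run above
    [last 0 p1]. *)
Lemma srw_cat (p1 p2 v : seq nat) :
  path ltn 0 (p1 ++ p2) -> p2 != [::] ->
  1 < size p2 \/ (exists2 x, ohead v = Some x & x < last 0 p1) ->
  (forall x, ohead v = Some x -> (head 0 p2 < x) || (x < last 0 p1)) ->
  srw (p1 ++ rev p2 ++ v) = p1 ++ rev p2.
Proof.
move=> incp p2N0; set w := p1 ++ _ => long v_out.
have p2_gt0 : 0 < size p2 by case: (p2) p2N0.
have Tinc i j := @ltn_letter_path _ i j incp; rewrite size_cat in Tinc.
have wl j (jp : j <= size p1) : letter w j = _ := letter_wavel p2 v jp.
have wr j (jp : size p1 < j <= size p1 + size p2) : letter w j = _ := letter_waver v jp.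
have szw : size w = size p1 + size p2 + size v by rewrite !size_cat size_rev addnA.
have [dt tw] : desc_at w (size p1).+1 /\ (size p1).+1 < size w.
  have [lt1p|] := ltnP 1 (size p2).
    by split; [rewrite /desc_at !wr; [apply: Tinc| |]; lia | lia].
  case: long => [|[x ov ltx] lep1]; first by lia.
  have /eqP sz1 : size p2 == 1 by lia.
  split; last by rewrite szw; case: (v) ov => //= *; lia.
  rewrite /desc_at (wr (size p1).+1); last lia.
  have -> : letter w (size p1).+2 = x.
    have -> : (size p1).+2 = size (p1 ++ rev p2) + 1.
      by rewrite size_cat size_rev sz1; lia.
    by rewrite /w catA letter_catr; case: (v) ov => //= ? ? [].
  apply: ltn_trans ltx _; rewrite -letter_size -(@letter_catl p1 p2) //.
  by apply: Tinc; lia.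
have Nincw : ~~ increasing w.
  apply/increasingP => /(_ (size p1).+1); move: dt; rewrite /desc_at; lia.
have Dt : first_descent w = (size p1).+1.
  apply: first_descent_eq => // j jp; rewrite /desc_at -leqNgt ltnW //.
  have [jp'|jp'] := ltnP j (size p1); first by rewrite !wl; [apply: Tinc| |]; lia.
  by rewrite wl ?wr; [apply: Tinc| |]; lia.
rewrite /srw (negbTE Nincw) Dt /=.
rewrite (@max_in_eq _ _ (size p1 + size p2)).
- by rewrite /factor drop0 /w catA take_size_cat // size_cat size_rev.
- lia.
- apply/andP; split; last by rewrite wl ?wr; [apply: Tinc| |]; lia.
  by apply/decreasing_onP => j jp; rewrite !wr; [apply: Tinc| |]; lia.
(* A longer run would contain the first letter [x] of [v], whence
   [last 0 p1 < w_j <= x < head 0 p2], which the hypothesis on [v] excludes. *)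
move=> j jw; apply/negP => /andP[dec gt_j].
case: v @w v_out {long dt tw Nincw Dt} wl wr szw jw dec gt_j => [|x v] w; first by move=> /=; lia.
move=> /(_ x erefl) x_out wl wr szw jw dec gt_j.
have wx : letter w (size p1 + size p2).+1 = x.
  by rewrite /w catA -(size_rev p2) -size_cat -addn1 letter_catr.
have := decreasing_on_leq dec (_ : _ <= (size p1 + size p2).+1) => /(_ j).
rewrite wx; have /decreasing_onP/(_ (size p1 + size p2)) := dec; rewrite wx wr; last lia.
have -> : letter (p1 ++ p2) (size p1 + (size p2 - (size p1 + size p2 - size p1)).+1) = head 0 p2.
  by rewrite addKn subnn letter_catr nth0.
move: gt_j; rewrite -(letter_size p1) in x_out *; rewrite wl //= letter_catl // in x_out *; lia.
Qed.

Lemma last_rev (T : Type) (x : T) (s : seq T) : last x (rev s) = head x s.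
Proof. by case: s => // y s; rewrite rev_cons last_rcons. Qed.

(** The first descent leads from the last letter of [c2] to the largest letter of [c1]. As the
    letters of [v1] are below and those of [c2] above the latter, the wave starts at the first
    letter of [c2], and its lower bound is [last 0 v1]. *)
Lemma sw_cat (v1 c1 c2 v2 : seq nat) :
  path ltn 0 (v1 ++ c1 ++ c2) -> c1 != [::] -> c2 != [::] ->
  (forall x, ohead v2 = Some x -> (head 0 c1 < x) || (x < last 0 v1)) ->
  sw (v1 ++ (c2 ++ rev c1) ++ v2) = c2 ++ rev c1.
Proof.
move=> incb c1N0 c2N0; set w := v1 ++ _ => v2_out.
have c1_gt0 : 0 < size c1 by case: (c1) c1N0.
have c2_gt0 : 0 < size c2 by case: (c2) c2N0.
set b := v1 ++ _ in incb; set p := size v1; set m := size c1; set q := size c2.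
have szb : size b = p + m + q by rewrite !size_cat addnA.
have Tinc i j := @ltn_letter_path _ i j incb; rewrite szb in Tinc.
have w1 j : j <= p -> letter w j = letter b j.
  by move=> jp; rewrite !letter_catl.
have w2 j : p < j <= p + q -> letter w j = letter b (j + m).
  move=> jp; rewrite /w -catA letter_cat ifN; last by rewrite -/p; lia.
  rewrite letter_catl; last by rewrite -/p -/q; lia.
  rewrite /b catA letter_cat ifN; last by rewrite size_cat -/p -/m; lia.
  by congr letter; rewrite size_cat -/p -/m; lia.
have w3 j : p + q < j <= p + q + m -> letter w j = letter b (p + (p + q + m - j).+1).
  move=> jp; rewrite /w -catA letter_cat ifN; last by rewrite -/p; lia.
  rewrite letter_cat ifN; last by rewrite -/p -/q; lia.
  rewrite letter_catl ?letter_rev ?size_rev -/p -/q -/m; try lia.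
  rewrite /b letter_catr nth_cat ifT -/m; last lia.
  by congr nth; lia.
have szw : size w = p + q + m + size v2.
  by rewrite !size_cat size_rev -/p -/q -/m; lia.
have dt : desc_at w (p + q).
  by rewrite /desc_at (w2 (p + q)) ?w3; [apply: Tinc| |]; lia.
have Nincw : ~~ increasing w.
  by apply/increasingP => /(_ (p + q)); move: dt; rewrite /desc_at; lia.
have Dt : first_descent w = p + q.
  apply: first_descent_eq => //; first lia.
  move=> j jp; rewrite /desc_at -leqNgt ltnW //.
  have [ltjp|lejp] := ltnP j p; first by rewrite !w1; [apply: Tinc| |]; lia.
  have [->|nejp] := eqVneq j p; first by rewrite w1 ?w2; [apply: Tinc| |]; lia.
  by rewrite !w2; [apply: Tinc| |]; lia.
rewrite /sw (negbTE Nincw) Dt.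
rewrite (@min_in_eq _ _ p.+1); first last.
- move=> j jp; rewrite -leqNgt ltnW //.
  by rewrite w1 ?w3; [apply: Tinc| |]; lia.
- by rewrite (w2 p.+1) ?w3; [apply: Tinc| |]; lia.
- lia.
rewrite succnK (@max_in_eq _ _ (p + q + m)).
- rewrite /factor /= /w catA take_size_cat; last by rewrite !size_cat size_rev -/p -/q -/m addnA.
  by rewrite drop_size_cat.
- lia.
- apply/andP; split; last by rewrite w1 ?w3; [apply: Tinc| |]; lia.
  by apply/decreasing_onP => j jp; rewrite !w3; [apply: Tinc| |]; lia.
move=> j jw; apply/negP => /andP[dec gt_j].
case: v2 @w v2_out {dt Nincw Dt} w1 w2 w3 szw jw dec gt_j => [|x v2] w; first by move=> /=; lia.
move=> /(_ x erefl) x_out w1 w2 w3 szw jw dec gt_j.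
have wx : letter w (p + q + m).+1 = x.
  have -> : p + q + m = size (v1 ++ c2 ++ rev c1).
    by rewrite !size_cat size_rev -/p -/q -/m addnA.
  by rewrite /w catA -addn1 letter_catr.
have := decreasing_on_leq dec (_ : _ <= (p + q + m).+1) => /(_ j).
rewrite wx; have /decreasing_onP/(_ (p + q + m)) := dec; rewrite wx w3; last lia.
have -> : letter b (p + (p + q + m - (p + q + m)).+1) = head 0 c1.
  by rewrite subnn letter_catr nth0; case: (c1) c1N0.
move: gt_j; rewrite w1 // /b letter_catl // letter_size; lia.
Qed.

(** * Inserting a wave into a word *)

(* [w] is inserted after the longest increasing prefix of [v] whose letters lie
   strictly between [a] and [c]. *)
Fixpoint wave_insert (w : seq nat) (c a : nat) (v : seq nat) : seq nat :=
  if v is x :: v' then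
    if a < x < c then x :: wave_insert w c x v' else w ++ v
  else w.

Lemma wave_insertP (w v : seq nat) (c a : nat) : a < c ->
  exists v1 v2, [/\ v = v1 ++ v2, wave_insert w c a v = v1 ++ w ++ v2,
    path ltn a v1, last a v1 < c &
    forall x, ohead v2 = Some x -> (c <= x) || (x <= last a v1)].
Proof.
elim: v a => [|x v IHv] a lt_ac; first by exists [::], [::]; rewrite /= cats0.
rewrite /=; case: ifP => [/andP[lt_ax lt_xc]|x_out].
  have [v1 [v2 [-> -> incv1 ltv1 v2_out]]] := IHv x lt_xc.
  by exists (x :: v1), v2; split=> //=; apply/andP.
exists [::], (x :: v); split=> // y [<-].
by move/negbT: x_out; rewrite negb_and -!leqNgt orbC.
Qed.

(* The letters [b], arranged as a wave with [j] descents, are inserted into [v] at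
   the only place where they become its special wave. *)
Definition dec_sw (b v : seq nat) (j : nat) : seq nat :=
  wave_insert (drop j b ++ rev (take j b)) (head 0 b) 0 v.

(* The wave placed in front of [v] has [j] descents, or [j - 1] when its junction
   with [v] supplies the missing one. *)
Definition dec_srw (b v : seq nat) (j : nat) : seq nat :=
  let q := size b - j in
  let p := if has (ltn^~ (nth 0 b q.-1)) (take 1 v) then q else q.-1 in
  take p b ++ rev (drop p b) ++ v.

(** The conclusions of [wave_dec] make the insertion reversible: the letters of the wave give back
    [b], deleting them gives back [v], and the growth of [des] gives back [j]. Together with
    [wave_increasing], for words without hooks, they are all that the bijection uses of either
    wave. *)
Record wave_insertion (W : seq nat -> seq nat)
    (dec : seq nat -> seq nat -> nat -> seq nat) : Prop := {
  wave_increasing : forall w, increasing w -> W w = w;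
  wave_dec : forall (b v : seq nat) (j : nat), uniq (b ++ v) -> path ltn 0 b -> 0 \notin v ->
    0 < j < size b ->
    [/\ perm_eq (dec b v j) (b ++ v),
        [seq x <- dec b v j | x \notin b] = v,
        perm_eq (W (dec b v j)) b
      & des (dec b v j) = des v + j] }.

Lemma filter_notin_insert (b c v1 v2 : seq nat) :
  uniq (b ++ v1 ++ v2) -> perm_eq c b ->
  [seq x <- v1 ++ c ++ v2 | x \notin b] = v1 ++ v2.
Proof.
rewrite cat_uniq => /and3P[_ /hasPn v_b _] /perm_mem eqcb.
rewrite !filter_cat [X in _ ++ X ++ _](_ : _ = [::]) ?cat0s.
  rewrite -filter_cat; apply/all_filterP/allP => x /v_b //.
rewrite -(filter_pred0 c); apply: eq_in_filter => x.
by rewrite eqcb => ->.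
Qed.

Lemma perm_cat_rev_drop (b : seq nat) (p : nat) : perm_eq (take p b ++ rev (drop p b)) b.
Proof. by rewrite -{3}(cat_take_drop p b) perm_cat2l perm_rev. Qed.

(** The inserted wave has one descent where its two parts meet and [j - 1] in its reversed part. It
    is entered by an ascent, and it is left by a descent exactly when [v] already had a descent at
    the place of insertion. *)
Lemma wave_insertion_sw : wave_insertion sw dec_sw.
Proof.
split=> [w incw|b v j Ubv incb v_gt0 jb]; first by rewrite /sw incw.
have b_gt0 : 0 < head 0 b by case: (b) incb jb => [|x b'] /=; [lia | case/andP].
rewrite /dec_sw; have [v1 [v2 [Dv -> incv1 lt1 v2_out]]] :=
  wave_insertP (drop j b ++ rev (take j b)) v b_gt0.
have pb : perm_eq (drop j b ++ rev (take j b)) b.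
  by rewrite -{3}(cat_take_drop j b) perm_catC perm_cat2r perm_rev.
case/andP: (jb) => j_gt0 lt_jb.
have tN0 : take j b != [::] by rewrite -size_eq0 size_takel ?(ltnW lt_jb) -?lt0n.
have dN0 : drop j b != [::] by rewrite -size_eq0 size_drop -lt0n subn_gt0.
have ht : head 0 (take j b) = head 0 b by case: (b) (j) jb => [|? ?] [|?] //=; lia.
have inc : path ltn 0 (v1 ++ take j b ++ drop j b).
  rewrite cat_take_drop cat_path incv1; case: (b) lt1 incb => //= x b' -> /andP[_ ->] //.
rewrite Dv in Ubv v_gt0 *.
(* Distinctness of the letters makes the inequalities of [wave_insertP] strict. For empty [v1],
   [last 0 v1] is the default 0, which is not a letter of [v]. *)
have v2_out' x : ohead v2 = Some x -> (head 0 (take j b) < x) || (x < last 0 v1).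
  rewrite ht => ov2; have := v2_out x ov2; rewrite leq_eqVlt [x <= _]leq_eqVlt.
  have xv2 : x \in v2 by case: (v2) ov2 => //= ? ? [->]; rewrite mem_head.
  move: Ubv; rewrite cat_uniq => /and3P[_ /hasPn /(_ x) xNb].
  rewrite mem_cat xv2 orbT in xNb; rewrite cat_uniq => /and3P[_ /hasPn /(_ x xv2) xNv1 _].
  have /negbTE -> : head 0 b != x.
    apply: contraNneq (xNb isT) => <-; by case: (b) jb => [|y b'] /=; rewrite ?mem_head //; lia.
  have /negbTE -> //: x != last 0 v1.
  case: (lastP v1) xNv1 v_gt0 => [|s y] /=; last first.
    rewrite last_rcons mem_rcons inE negb_or => /andP[] //.
  by move=> _; apply: contraNneq => <-.
split.
- by rewrite perm_catCA perm_cat2r.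
- exact: filter_notin_insert.
- by rewrite sw_cat.
have szt : size (take j b) = j by rewrite size_takel //; lia.
rewrite -ht in lt1.
case: (lastP (take j b)) (drop j b) szt tN0 dN0 inc lt1 v2_out' => [//|t z] [//|y d].
rewrite size_rcons => szt _ _ inc lt1 {}v2_out.
move: (inc); rewrite cat_path => /andP[_]; rewrite cat_path last_rcons => /andP[inct incd].
have lt_z : z < last 0 (y :: d).
  by have /allP/(_ (last y d) (mem_last _ _)) := order_path_min ltn_trans incd.
have incd' := path_sorted incd.
have dc : des ((y :: d) ++ rev (rcons t z)) = j.
  rewrite rev_rcons des_cat (des_increasing incd') lt_z -rev_rcons.
  by rewrite des_rev_increasing ?size_rcons; [lia | exact: path_sorted inct].
have lt_y : last 0 v1 < y.
  have /allP/(_ z) := order_path_min ltn_trans inct.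
  rewrite mem_rcons mem_head => /(_ isT) /= lt_vz.
  by case/andP: incd => /(ltn_trans lt_vz).
rewrite cat_cons des_cat (des_increasing (path_sorted incv1)).
rewrite ltnNge (ltnW lt_y) /= add0n -cat_cons.
case: v2 {Ubv v_gt0 Dv} v2_out => [|x v2] v2_out.
  by rewrite !cats0 dc (des_increasing (path_sorted incv1)).
have lc : last 0 ((y :: d) ++ rev (rcons t z)) = head 0 (rcons t z).
  by rewrite last_cat last_rev; case: (t).
(* Since [last 0 v1 < head 0 (rcons t z)] and [x] does not lie between them, [x] is below both or
   above both. *)
rewrite !des_cat dc (des_increasing (path_sorted incv1)) lc.
have := v2_out x erefl; lia.
Qed.

Lemma des_wave (p1 p2 : seq nat) :
  path ltn 0 (p1 ++ p2) -> des (p1 ++ rev p2) = (size p2).-1.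
Proof.
rewrite cat_path => /andP[/path_sorted inc1].
case/lastP: p2 => [|s y] inc2; first by rewrite cats0 des_increasing.
have d2 := des_rev_increasing (path_sorted inc2).
rewrite rev_rcons in d2 *; rewrite des_cat d2 (des_increasing inc1).
rewrite [_ < _](_ : _ = false) //; apply/negbTE; rewrite -leqNgt; apply: ltnW.
have /allP/(_ y) := order_path_min ltn_trans inc2.
by rewrite mem_rcons mem_head; exact.
Qed.

Lemma wave_insertion_srw : wave_insertion srw dec_srw.
Proof.
split=> [w incw|b v j Ubv incb v_gt0 jb]; first by rewrite /srw incw.
case/andP: (jb) => j_gt0 lt_jb.
rewrite /dec_srw; set q := size b - j; set p := if _ then _ else _.
pose p1 := take p b; pose p2 := drop p b; rewrite -/p1 -/p2.
have q_gt0 : 0 < q by rewrite /q; lia.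
have lt_qb : q.-1 < size b by rewrite /q; lia.
have p_lt : p < size b by rewrite /p /q; case: ifP; lia.
have sz1 : size p1 = p by rewrite size_takel // ltnW.
have sz2 : size p2 = size b - p by rewrite size_drop.
have inc : path ltn 0 (p1 ++ p2) by rewrite cat_take_drop.
have Tinc i1 i2 := @ltn_letter_path _ i1 i2 incb.
have l1 : last 0 p1 = letter b p.
  by rewrite -letter_size sz1 -[in RHS](cat_take_drop p b) letter_catl ?sz1.
have h2 : head 0 p2 = letter b p.+1 by rewrite -nth0 nth_drop addn0.
have Dcase x : ohead v = Some x -> x \notin b.
  move=> ov; move: Ubv; rewrite cat_uniq => /and3P[_ /hasPn /(_ x) xNb _].
  by apply: xNb; case: (v) ov => //= ? ? [->]; rewrite mem_head.
(* The test defining [p] compares [x] with the [q]-th letter of [b]. This letter is the last one of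
   [p1] if [p = q] and the first one of [p2] if [p = q - 1]; it differs from [x] because [x] is not
   in [b]. *)
have vcase x : ohead v = Some x ->
    p = q /\ x < last 0 p1 \/ p = q.-1 /\ head 0 p2 < x.
  move=> ov; have := Dcase x ov; rewrite l1 h2 /p.
  case: (v) ov => //= ? ? [->]; rewrite take0 /= orbF.
  have qE : nth 0 b q.-1 = letter b q by by case: (q) q_gt0.
  rewrite qE; case: ltnP => [|le_x] xNb; [by left | right; split=> //].
  rewrite prednK //.
  rewrite ltn_neqAle le_x andbT; apply: contraNneq xNb => <-.
  by rewrite -qE mem_nth.
have v0 : ohead v = None -> p = q.-1 by rewrite /p; case: (v).
have d12 : des (p1 ++ rev p2) = (size b - p).-1 by rewrite des_wave ?sz2.
rewrite catA; split.
- by rewrite perm_cat2r perm_cat_rev_drop.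
- rewrite -[X in filter _ X]/([::] ++ (p1 ++ rev p2) ++ v).
  by rewrite filter_notin_insert // perm_cat_rev_drop.
- rewrite -catA srw_cat ?perm_cat_rev_drop //.
  + by rewrite -size_eq0 sz2; lia.
  (* For [p = q - 1] the block [p2] has [j + 1 > 1] letters; for [p = q] it may have only one, but
     then [x] is below [last 0 p1]. *)
  + case Dv: {+}(ohead v) => [x|]; last by left; rewrite sz2; have := v0 Dv; lia.
    have [[_ ltx]|[pE _]] := vcase x Dv; last by left; lia.
    by right; exists x.
  + move=> x /vcase; lia.
clearbody p1 p2; clearbody p.
case: v {Ubv v_gt0 Dcase} vcase v0 => [|x v] vcase v0.
  by rewrite cats0 d12 add0n; have := v0 erefl; rewrite /q; lia.
rewrite des_cat d12 last_cat last_rev.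
have -> : head (last 0 p1) p2 = head 0 p2 by case: (p2) sz2 => //=; lia.
have := vcase x erefl; have := @Tinc p p.+1; rewrite l1 h2 /q; lia.
Qed.

(** * Inversions of hooks *)

Lemma inv_sumn (w : seq nat) :
  inv w = sumn [seq count (fun q => (p < q) && (letter w q < letter w p))
                          (iota 1 (size w)) | p <- iota 1 (size w)].
Proof.
rewrite /inv count_flatten -map_comp; congr sumn; apply: eq_map => p /=.
by rewrite count_map.
Qed.

Lemma inv_hook (a : nat) (b : seq nat) :
  increasing b -> inv (a :: b) = count (gtn a) b.
Proof.
move=> incb; rewrite inv_sumn; set F := fun p => count _ _.
(* Positions from 2 on lie in the increasing part, so every inversion involves the first letter. *)
have F0 : {in iota 2 (size b), F =1 fun=> 0}.
  move=> p; rewrite mem_iota => pb.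
  apply/eqP; rewrite -leqn0 leqNgt -has_count.
  apply/hasPn => q; rewrite mem_iota /= => qb; apply/negP => /andP[lt_pq].
  have -> : letter (a :: b) p = nth 0 b p.-2 by case: p pb {lt_pq} => [|[]].
  have -> : letter (a :: b) q = nth 0 b q.-2 by case: q qb lt_pq => [|[]] //; lia.
  apply/negP; rewrite -leqNgt ltnW //.
  have /(_ p.-2 q.-2) := sorted_ltn_nth ltn_trans 0 incb.
  by apply; rewrite ?inE /=; lia.
have -> : sumn (map F (iota 1 (size b).+1)) = F 1.
  rewrite /= -[RHS]addn0; have /eq_in_map -> := F0; congr addn.
  by elim: (iota _ _).
rewrite /F /= add0n (iotaDl 2 0) count_map -[b in RHS](mkseq_nth 0) count_map.
exact: eq_count.
Qed.

Lemma inv_hook_bounds (h : seq nat) : is_hook h -> 0 < inv h < size h.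
Proof.
case: h => [|a [|b h]] //= /andP[lt_ba inch].
rewrite inv_hook //= lt_ba /= ltnS; exact: (count_size (gtn a) h).
Qed.

Lemma count_gtn_inj (s : seq nat) :
  {in s &, injective (fun a => count (gtn a) s)}.
Proof.
have lt_count a a' : a \in s -> a < a' -> count (gtn a) s < count (gtn a') s.
  move=> a_s lt_aa'; have : 0 < count_mem a s by rewrite -has_count has_pred1.
  suff : count (gtn a) s + count_mem a s <= count (gtn a') s by lia.
  by elim: (s) => //= x s' IH; lia.
move=> a a' a_s a'_s /= eq_c; have [lt|lt|//] := ltngtP a a'.
  by have := lt_count _ _ a_s lt; rewrite eq_c ltnn.
by have := lt_count _ _ a'_s lt; rewrite eq_c ltnn.
Qed.

(** The number of inversions is the rank of the first letter among all letters, which determines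
    that letter; the others follow in increasing order. *)
Lemma hook_inj (h h' : seq nat) :
  is_hook h -> is_hook h' -> perm_eq h h' -> inv h = inv h' -> h = h'.
Proof.
case: h h' => [|a b] [|a' b'] //.
have hookP x y : is_hook (x :: y) -> increasing y /\ inv (x :: y) = count (gtn x) (x :: y).
  by case: y => //= z y /andP[_ incy]; rewrite inv_hook //= ltnn.
move=> /hookP[incb ->] /hookP[incb' ->] eqh; rewrite -(seq.permP eqh) => eqc.
have Daa' : a = a'.
  by apply: (count_gtn_inj _ _ eqc); [|rewrite (perm_mem eqh)]; exact: mem_head.
move: eqh; rewrite Daa' perm_cons => eqb; congr cons.
exact: (irr_sorted_eq ltn_trans ltnn incb incb' (perm_mem eqb)).
Qed.

(** * Replacing all hooks by waves *)

Lemma path0_sorted (s : seq nat) : sorted ltn s -> 0 \notin s -> path ltn 0 s.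
Proof.
case: s => //= x s ->; rewrite inE negb_or andbT => /andP[x0 _].
by rewrite lt0n eq_sym.
Qed.

Lemma path0_sort (s : seq nat) : uniq s -> 0 \notin s -> path ltn 0 (sort leq s).
Proof.
move=> Us s0; apply: path0_sorted; last by rewrite mem_sort.
by rewrite ltn_sorted_uniq_leq sort_uniq Us sort_sorted //; exact: leq_total.
Qed.

(* Hooks are turned into waves from left to right; a hook is determined by its
   letters and its number of inversions. *)
Definition hooks_to_waves (dec : seq nat -> seq nat -> nat -> seq nat)
    (g : seq nat) (hs : seq (seq nat)) : seq nat :=
  foldl (fun v h => dec (sort leq h) v (inv h)) g hs.

Section HooksToWaves.

Variables (W : seq nat -> seq nat) (dec : seq nat -> seq nat -> nat -> seq nat).
Hypothesis decP : wave_insertion W dec.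

Let valid g hs := [&& increasing g, all is_hook hs,
  uniq (g ++ flatten hs) & 0 \notin g ++ flatten hs].

Lemma hooks_to_waves_rcons (g : seq nat) (hs : seq (seq nat)) (h : seq nat) :
  hooks_to_waves dec g (rcons hs h) =
  dec (sort leq h) (hooks_to_waves dec g hs) (inv h).
Proof. by rewrite /hooks_to_waves foldl_rcons. Qed.

Let valid_rcons g hs h : valid g (rcons hs h) ->
  [/\ valid g hs, is_hook h, uniq ((g ++ flatten hs) ++ h), uniq h & 0 \notin h].
Proof.
case/and4P=> incg; rewrite all_rcons => /andP[hook_h hook_hs].
rewrite flatten_rcons catA => U; rewrite mem_cat negb_or => /andP[N0 N0h].
have := U; rewrite {1}cat_uniq => /and3P[U1 _ U2].
by split=> //; rewrite /valid incg hook_hs U1.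
Qed.

Let valid_dec g hs h (v := hooks_to_waves dec g hs) : valid g (rcons hs h) ->
  perm_eq v (g ++ flatten hs) ->
  [/\ perm_eq (dec (sort leq h) v (inv h)) (v ++ h),
      [seq x <- dec (sort leq h) v (inv h) | x \notin h] = v,
      perm_eq (W (dec (sort leq h) v (inv h))) h
    & des (dec (sort leq h) v (inv h)) = des v + inv h].
Proof.
case/valid_rcons => /and4P[_ _ _ N0] hook_h U Uh N0h eqv.
have [] := wave_dec decP (b := sort leq h) (v := v) (j := inv h).
- rewrite (perm_uniq (_ : perm_eq _ ((g ++ flatten hs) ++ h))) //.
  by rewrite perm_catC; apply: perm_cat; rewrite ?perm_sort.
- exact: path0_sort.
- by rewrite (perm_mem eqv).
- by rewrite size_sort inv_hook_bounds.
move=> eqw filt eqW desw; split=> //.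
- by rewrite (perm_trans eqw) // perm_catC perm_cat2l perm_sort.
- by rewrite -[RHS]filt; apply: eq_filter => x; rewrite mem_sort.
by rewrite (perm_trans eqW) // perm_sort.
Qed.

Lemma hooks_to_waves_spec (g : seq nat) (hs : seq (seq nat)) : valid g hs ->
  [/\ perm_eq (hooks_to_waves dec g hs) (g ++ flatten hs),
      des (hooks_to_waves dec g hs) = sumn [seq inv h | h <- hs]
    & size (W (hooks_to_waves dec g hs)) = size (last g hs)].
Proof.
elim/last_ind: hs => [|hs h IHhs] V.
  case/and4P: V => incg _ _ _; rewrite /= cats0; split=> //; first exact: des_increasing.
  by rewrite (wave_increasing decP).
have [/IHhs[eqv desv _] _ _ _ _] := valid_rcons V.
have [eqw _ eqW desw] := valid_dec V eqv.
rewrite hooks_to_waves_rcons; split.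
- by rewrite (perm_trans eqw) // flatten_rcons catA perm_cat2r.
- by rewrite desw desv map_rcons sumn_rcons.
by rewrite last_rcons (perm_size eqW).
Qed.

(** Induction from the right: the wave of the result reveals the letters of the last hook, deleting
    them leaves the result for the earlier hooks, and the difference in [des] is the number of
    inversions, so [hook_inj] applies. The number of hooks cannot differ, since each hook adds at
    least one descent. *)
Lemma hooks_to_waves_inj (g g' : seq nat) (hs hs' : seq (seq nat)) :
  valid g hs -> valid g' hs' ->
  hooks_to_waves dec g hs = hooks_to_waves dec g' hs' -> g = g' /\ hs = hs'.
Proof.
have inv_gt0 gg hh h : valid gg (rcons hh h) -> 0 < sumn [seq inv x | x <- rcons hh h].
  by case/valid_rcons => _ /inv_hook_bounds + _ _ _; rewrite map_rcons sumn_rcons; lia.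
have waveP gg hh h : valid gg (rcons hh h) ->
    [/\ [seq x <- hooks_to_waves dec gg (rcons hh h) | x \notin h]
          = hooks_to_waves dec gg hh,
        perm_eq (W (hooks_to_waves dec gg (rcons hh h))) h
      & des (hooks_to_waves dec gg (rcons hh h)) =
        des (hooks_to_waves dec gg hh) + inv h].
  move=> V; have [/hooks_to_waves_spec[eqv _ _] _ _ _ _] := valid_rcons V.
  by rewrite hooks_to_waves_rcons; have [] := valid_dec V eqv.
elim/last_ind: hs hs' => [|hs h IHhs] hs' V; case/lastP: hs' => [|hs' h'] V'.
- by [].
- move/(congr1 des); have [_ -> _] := hooks_to_waves_spec V.
  by have [_ -> _] := hooks_to_waves_spec V'; have := inv_gt0 _ _ _ V' => /= + E; rewrite -E.
- move/(congr1 des); have [_ -> _] := hooks_to_waves_spec V.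
  by have [_ -> _] := hooks_to_waves_spec V'; have := inv_gt0 _ _ _ V => /= + E; rewrite E.
have [f1 s1 d1] := waveP _ _ _ V; have [f2 s2 d2] := waveP _ _ _ V'.
move=> E; rewrite E in f1 s1 d1.
have eqh : perm_eq h h' by rewrite perm_sym in s1; exact: perm_trans s1 s2.
have Ev : hooks_to_waves dec g hs = hooks_to_waves dec g' hs'.
  by rewrite -f1 -f2; apply: eq_filter => x; rewrite (perm_mem eqh).
have [Vhs hook_h _ _ _] := valid_rcons V; have [Vhs' hook_h' _ _ _] := valid_rcons V'.
have [-> ->] := IHhs _ Vhs Vhs' Ev; split=> //; congr rcons.
by apply: hook_inj => //; move: d1; rewrite d2 Ev => /addnI.
Qed.

Definition word_to_waves (w : seq nat) : seq nat :=
  hooks_to_waves dec (hook_factorization w).1 (hook_factorization w).2.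

Let hook_factorization_valid (w : seq nat) : uniq w -> 0 \notin w ->
  w = (hook_factorization w).1 ++ flatten (hook_factorization w).2 /\
  valid (hook_factorization w).1 (hook_factorization w).2.
Proof.
move=> Uw w0; have /and3P[/eqP Dw incg hook_hs] := hook_factorizationP Uw.
by split=> //; rewrite /valid incg hook_hs -Dw Uw.
Qed.

Lemma word_to_waves_spec (w : seq nat) : uniq w -> 0 \notin w ->
  [/\ perm_eq (word_to_waves w) w, des (word_to_waves w) = lec w
    & size (W (word_to_waves w)) = size (rightmost_hook w)].
Proof.
move=> Uw w0; have [Dw V] := hook_factorization_valid Uw w0.
have [eqw desw szw] := hooks_to_waves_spec V.
split=> //; first by rewrite [X in perm_eq _ X]Dw.
rewrite szw /rightmost_hook; case: (_.2) Dw => //=.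
by rewrite cats0 => <-.
Qed.

Lemma word_to_waves_inj (w w' : seq nat) :
  uniq w -> 0 \notin w -> uniq w' -> 0 \notin w' ->
  word_to_waves w = word_to_waves w' -> w = w'.
Proof.
move=> Uw w0 Uw' w0'; have [Dw V] := hook_factorization_valid Uw w0.
have [Dw' V'] := hook_factorization_valid Uw' w0'.
case/(hooks_to_waves_inj V V') => E1 E2.
by rewrite Dw Dw' E1 E2.
Qed.

End HooksToWaves.

(** * Prefixes contained in the special reverse wave *)

Lemma letter_take (w : seq nat) (m j : nat) :
  j <= m -> m <= size w -> letter (take m w) j = letter w j.
Proof.
by move=> jm mw; rewrite -[in RHS](cat_take_drop m w) letter_catl // size_takel.
Qed.

(** The position [t] itself is an admissible end of the wave, since [w_(t-1) < w_t]; for [t = 1]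
    this reads [0 < w_1]. Hence the maximum defining [s] is attained. *)
Lemma srw_take (w : seq nat) : uniq w -> 0 \notin w -> ~~ increasing w ->
  let t := first_descent w in
  exists s, [/\ srw w = take s w, t <= s <= size w,
    decreasing_on w t s, letter w t.-1 < letter w s &
    forall j, t <= j <= size w -> decreasing_on w t j ->
      letter w t.-1 < letter w j -> j <= s].
Proof.
move=> Uw w0 Nincw; have [tw dt asct] := first_descentP Uw Nincw.
rewrite /srw (negbTE Nincw); set t := first_descent w in tw dt asct *.
pose P s := decreasing_on w t s && (letter w t.-1 < letter w s).
have Pt : P t.
  apply/andP; split; first by apply/decreasing_onP => j; lia.
  case: (ltnP 1 t) => [lt1t|le_t1]; first by have := asct t.-1; rewrite prednK; lia.
  have -> : t = 1 by lia.
  have : letter w 1 \in w by apply: (@mem_nth _ 0 w 0); case/andP: tw => _; exact: leq_ltn_trans.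
  by rewrite lt0n; apply: contraTneq => ->.
have tt : t <= t <= size w by lia.
have [ts _ sw' /andP[decs lts]] := max_inP tt Pt.
exists (max_in t (size w) P); split=> //; first by rewrite /factor drop0.
  by rewrite ts.
move=> j tj decj ltj; have Pj : P j by rewrite /P decj.
by have [] := max_inP tj Pj.
Qed.

(** A prefix of the wave rises to its peak and then falls while staying above the letter before the
    peak, so reversing the falling part sorts it. The letter [y], the last one of the prefix, is
    singled out because it plays the role of [rho_1]. *)
Lemma leq_size_srwP (w : seq nat) (m : nat) :
  uniq w -> 0 \notin w -> 0 < m <= size w ->
  (m <= size (srw w)) <->
  exists p1 y p2, path ltn 0 (p1 ++ y :: p2) /\ take m w = p1 ++ rev (y :: p2).
Proof.
move=> Uw w0 mw; have szt : size (take m w) = m by rewrite size_takel //; lia.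
split=> [le_m|[p1 [y [p2 [inc Dw]]]]]; last first.
  have [incw|Nincw] := boolP (increasing w); first by rewrite /srw incw; lia.
  have [tw dt asct] := first_descentP Uw Nincw.
  have [s [-> tsw decs lts maxs]] := srw_take Uw w0 Nincw.
  set t := first_descent w in tw dt asct tsw decs lts maxs.
  rewrite size_takel; last lia.
  have [/leq_trans -> //|lt_tm] := leqP m t; first lia.
  have Ew : w = p1 ++ rev (y :: p2) ++ drop m w by rewrite catA -Dw cat_take_drop.
  have szm : m = size p1 + size (y :: p2) by rewrite -szt Dw size_cat size_rev.
  have Tinc i j := @ltn_letter_path _ i j inc; rewrite size_cat -szm in Tinc.
  have wl j : j <= size p1 -> letter w j = letter (p1 ++ y :: p2) j.
    by move=> jp; rewrite Ew letter_wavel.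
  have wr j : size p1 < j <= m ->
      letter w j = letter (p1 ++ y :: p2) (size p1 + (m - j).+1).
    by move=> jp; rewrite Ew letter_waver -?szm //; congr letter; lia.
  rewrite /= in szm.
  (* As [t < m], the first descent lies within the prefix, whose letters rise up to position
     [size p1 + 1] and fall after it. *)
  have Dt : t = (size p1).+1.
    apply/eqP; rewrite eqn_leq; apply/andP; split.
      rewrite leqNgt; apply/negP => lt_pt; have := asct (size p1).+1.
      rewrite !wr; try lia.
      by have := @Tinc (size p1 + (m - (size p1).+2).+1) (size p1 + (m - (size p1).+1).+1); lia.
    rewrite ltnNge; apply/negP => le_tp; move: dt; rewrite /desc_at (wl t) //.
    have [lt_tp|le_pt] := ltnP t (size p1).
      by rewrite wl //; have := @Tinc t t.+1; lia.
    rewrite wr; last lia.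
    by have := @Tinc t (size p1 + (m - t.+1).+1); lia.
  apply: maxs; first lia.
    apply/decreasing_onP => j jm; rewrite !wr; try lia.
    by apply: Tinc; lia.
  by rewrite Dt wl // wr; [apply: Tinc | ]; lia.
have inc_case : increasing (take m w) ->
    exists p1 y p2, path ltn 0 (p1 ++ y :: p2) /\ take m w = p1 ++ rev (y :: p2).
  (* An increasing prefix has the required form with [p2] empty. *)
  move=> inct; case: (lastP (take m w)) szt inct (mem_take (n0 := m) (s := w)) => [|u y].
    by move=> /=; lia.
  move=> szt inct sub; exists u, y, [::]; split; last by rewrite cats1.
  rewrite cats1; apply: path0_sorted => //; apply: contra w0; exact: sub.
have [incw|Nincw] := boolP (increasing w).
  by apply: inc_case; apply: (subseq_sorted ltn_trans (take_subseq _ _)).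
have [tw dt asct] := first_descentP Uw Nincw.
have [s [Dsrw tsw decs lts _]] := srw_take Uw w0 Nincw.
set t := first_descent w in tw dt asct tsw decs lts.
move: le_m; rewrite Dsrw size_takel => [le_ms|]; last lia.
have inct q : q <= t -> increasing (take q w).
  move=> qt; have qw : q <= size w by lia.
  apply/increasingP => j; rewrite size_takel // => jq.
  by rewrite !letter_take //; [apply: asct | |]; lia.
have [le_mt|lt_tm] := leqP m t; first exact/inc_case/inct.
pose r := drop t.-1 (take m w).
have szr : size r = m - t.-1 by rewrite size_drop szt.
have nthr j : j < m - t.-1 -> nth 0 r j = letter w (t + j).
  move=> jr; rewrite nth_drop -[nth _ _ _]/(letter (take m w) (t.-1 + j).+1).
  by rewrite letter_take; [congr letter | |]; lia.
have decr : sorted gtn r.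
  apply/(sortedP 0) => j; rewrite szr => jr; rewrite !nthr; try lia.
  by move/decreasing_onP: decs => /(_ (t + j)); rewrite addnS /=; apply; lia.
have lastr : last 0 r = letter w m.
  by rewrite -nth_last nthr szr; [congr letter | ]; lia.
have [u [y Dr]] : exists u y, r = rcons u y.
  by case: (lastP r) szr => [/=|u y]; [lia | exists u, y].
rewrite Dr in decr; move: lastr; rewrite Dr last_rcons => Dy.
exists (take t.-1 w), y, (rev u); split; last first.
  rewrite rev_cons revK -Dr /r -[LHS](cat_take_drop t.-1) take_takel //; lia.
rewrite cat_path; apply/andP; split.
  apply: path0_sorted; first by apply: inct; lia.
  by apply: contra w0; exact: mem_take.
have lty : last 0 (take t.-1 w) < y.
  rewrite -letter_size size_takel; last lia.
  rewrite letter_take //; last lia.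
  rewrite Dy.
  by apply: (leq_trans lts); apply: (decreasing_on_leq decs); lia.
apply/andP; split; first exact: lty.
have incu : sorted ltn (y :: rev u) by rewrite -rev_rcons rev_sorted.
exact: incu.
Qed.

(** * Permutations as words, and the equality of the hook and wave counts *)

Lemma map_succ_enum_ord (n : nat) : [seq (val a).+1 | a <- enum 'I_n] = iota 1 n.
Proof. by rewrite (map_comp succn val) val_enum_ord (iotaDl 1 0). Qed.

Lemma perm_word_of_perm (n : nat) (s : 'S_n) : perm_eq (word_of_perm s) (iota 1 n).
Proof.
have inj_s : injective (fun j => (val (s j)).+1).
  by move=> i j [] /val_inj /perm_inj.
apply: uniq_perm; [by rewrite map_inj_uniq ?enum_uniq | exact: iota_uniq | move=> x].
rewrite -map_succ_enum_ord; apply/mapP/mapP => -[j _ ->].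
  by exists (s j); rewrite ?mem_enum.
by exists (s^-1%g j); rewrite ?mem_enum ?permKV.
Qed.

Lemma word_of_perm_uniq (n : nat) (s : 'S_n) : uniq (word_of_perm s).
Proof. by rewrite (perm_uniq (perm_word_of_perm s)) iota_uniq. Qed.

Lemma word_of_perm_gt0 (n : nat) (s : 'S_n) : 0 \notin word_of_perm s.
Proof. by rewrite (perm_mem (perm_word_of_perm s)) mem_iota. Qed.

Lemma size_word_of_perm (n : nat) (s : 'S_n) : size (word_of_perm s) = n.
Proof. by rewrite size_map size_enum_ord. Qed.

Lemma word_of_perm_inj (n : nat) : injective (@word_of_perm n).
Proof.
move=> s s' /eq_in_map E; apply/permP => j; apply: val_inj.
by apply: succn_inj; apply: (E j); rewrite mem_enum.
Qed.

Lemma word_of_perm_surj (n : nat) (w : seq nat) :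
  perm_eq w (iota 1 n) -> exists s : 'S_n, word_of_perm s = w.
Proof.
move=> eqw; have szw : size w = n by rewrite (perm_size eqw) size_iota.
have Uw : uniq w by rewrite (perm_uniq eqw) iota_uniq.
have nthw (j : 'I_n) : 0 < nth 0 w j <= n.
  have : nth 0 w j \in w by rewrite mem_nth ?szw.
  by rewrite (perm_mem eqw) mem_iota; lia.
pose f (j : 'I_n) : 'I_n := insubd j (nth 0 w j).-1.
have fE j : (val (f j)).+1 = nth 0 w j.
  by rewrite val_insubd; have := nthw j; case: ifP; lia.
have inj_f : injective f.
  move=> i j /(congr1 (succn \o val)) /=; rewrite -/(val _) -/(val _) !fE => /eqP.
  by rewrite nth_uniq ?szw // => /eqP /val_inj.
exists (perm inj_f); rewrite /word_of_perm.
under eq_map => j do rewrite permE fE.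
by rewrite (map_comp (nth 0 w) val) val_enum_ord -szw -/(mkseq _ _) mkseq_nth.
Qed.

(** [word_to_waves] induces an injective map of the finite set ['S_n] to itself, hence a bijection;
    the set on the right is the preimage of the one on the left. *)
Lemma card_wave_hook (W : seq nat -> seq nat)
    (dec : seq nat -> seq nat -> nat -> seq nat) (n i m : nat) :
  wave_insertion W dec ->
  #|[set s : 'S_n | (des (word_of_perm s) == i) && (m <= size (W (word_of_perm s)))]|
  = #|[set s : 'S_n | (lec (word_of_perm s) == i)
                      && (m <= size (rightmost_hook (word_of_perm s)))]|.
Proof.
move=> decP.
have specs (s : 'S_n) := word_to_waves_spec decP (word_of_perm_uniq s) (word_of_perm_gt0 s).
have /fin_all_exists[f fE] (s : 'S_n) :
    exists s' : 'S_n, word_of_perm s' = word_to_waves dec (word_of_perm s).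
  apply: word_of_perm_surj; have [eqw _ _] := specs s.
  exact: perm_trans eqw (perm_word_of_perm s).
have inj_f : injective f.
  move=> s s' Efs; apply/word_of_perm_inj/(word_to_waves_inj decP);
    rewrite ?word_of_perm_uniq ?word_of_perm_gt0 // -!fE Efs //.
rewrite -(card_preimset _ inj_f); apply: eq_card => s.
by rewrite !inE fE; have [_ -> ->] := specs s.
Qed.

(** * Pairs and special reverse waves *)

Lemma path0_filter_cat (p1 p2 : seq nat) (y : nat) : path ltn 0 (p1 ++ y :: p2) ->
  [seq z <- p1 ++ p2 | z < y] = p1 /\ [seq z <- p1 ++ p2 | y < z] = p2.
Proof.
move=> /path_sorted; rewrite (sorted_pairwise ltn_trans) pairwise_cat.
case/and3P=> /allrelP rel12 _ /andP[/allP gt2 _].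
have lt1 z : z \in p1 -> z < y by move=> z1; apply: rel12 => //; exact: mem_head.
have {}gt2 z : z \in p2 -> y < z by exact: gt2.
rewrite !filter_cat; split.
  rewrite (all_filterP (_ : all _ p1)); last exact/allP.
  rewrite [X in _ ++ X](eq_in_filter (a2 := pred0)) ?filter_pred0 ?cats0 //.
  by move=> z /gt2; case: ltngtP.
rewrite (all_filterP (_ : all _ p2)); last exact/allP.
rewrite [X in X ++ _](eq_in_filter (a2 := pred0)) ?filter_pred0 //.
by move=> z /lt1; case: ltngtP.
Qed.

(** This builds the [p1 ++ y :: p2] of [leq_size_srwP] from the letters of [alpha_0] and
    [y = rho_1]; [path0_filter_cat] shows that the splitting is unique. *)
Lemma path0_cat_filter (s : seq nat) (y : nat) : 0 < y -> path ltn 0 s ->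
  path ltn 0 ([seq z <- s | z < y] ++ y :: [seq z <- s | y < z]).
Proof.
move=> y_gt0 incs; apply: path0_sorted; last first.
  have s0 : 0 \notin s.
    by apply/negP; have /allP s_gt0 := order_path_min ltn_trans incs; move/s_gt0.
  by rewrite mem_cat inE !mem_filter (negbTE s0) !andbF orbF; case: (y) y_gt0.
have := path_sorted incs; rewrite !(sorted_pairwise ltn_trans) => pws.
rewrite pairwise_cat /= !pairwise_filter // !andbT; apply/andP; split.
  apply/allrelP => a b; rewrite mem_filter inE mem_filter => /andP[lta _].
  by case/orP=> [/eqP -> //|/andP[/(ltn_trans lta)]].
by apply/allP => a; rewrite mem_filter => /andP[].
Qed.

(* The prefix ending at [rho_1] lists the letters of [alpha_0] below [rho_1] in
   increasing order, then those above it in decreasing order, so that each of the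
   latter begins a descent. *)
Definition word_of_pair (n k : nat) (x : {set 'I_n} * k.+1.-tuple 'I_n) : seq nat :=
  let a := [seq (val c).+1 | c <- enum x.1] in
  let y := (val (thead x.2)).+1 in
  [seq z <- a | z < y] ++ rev [seq z <- a | y < z] ++ [seq (val c).+1 | c <- x.2].

Section WordOfPair.

Variables (n k : nat).
Implicit Type x : {set 'I_n} * k.+1.-tuple 'I_n.

Lemma perm_partial_word x : x \in partial_words n k.+1 ->
  perm_eq ([seq (val c).+1 | c <- enum x.1] ++ [seq (val c).+1 | c <- x.2]) (iota 1 n).
Proof.
rewrite inE => /andP[Ux /eqP Dx]; rewrite -map_cat -map_succ_enum_ord.
apply: perm_map; apply: uniq_perm; rewrite ?enum_uniq ?cat_uniq ?enum_uniq ?Ux ?andbT //.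
  by apply/hasPn => c cx /=; rewrite mem_enum Dx inE negbK.
by move=> c; rewrite mem_cat !mem_enum Dx inE; case: (c \in x.2).
Qed.

Lemma path0_map_succ_enum (A : {set 'I_n}) : path ltn 0 [seq (val c).+1 | c <- enum A].
Proof.
apply: path0_sorted; last by apply/mapP => -[].
apply: (subseq_sorted ltn_trans (s2 := iota 1 n)); last exact: iota_ltn_sorted.
by rewrite -map_succ_enum_ord map_subseq // enumT; exact: filter_subseq.
Qed.

Lemma map_succ_thead x :
  [seq (val c).+1 | c <- x.2] =
  (val (thead x.2)).+1 :: [seq (val c).+1 | c <- behead x.2].
Proof. by case: x => A t /=; rewrite {1}(tuple_eta t). Qed.

Lemma perm_filter_neq (s : seq nat) (y : nat) : y \notin s ->
  perm_eq ([seq z <- s | z < y] ++ [seq z <- s | y < z]) s.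
Proof.
move=> yNs; rewrite [X in _ ++ X](eq_in_filter (a2 := predC (gtn y))).
  by rewrite (perm_filterC (gtn y)).
move=> z zs /=.
rewrite -leqNgt [RHS]leq_eqVlt [y == z](_ : _ = false) //.
by apply: contraNF yNs => /eqP ->.
Qed.

Lemma word_of_pairP x : x \in partial_words n k.+1 ->
  let y := (val (thead x.2)).+1 in
  exists p1 p2, [/\ word_of_pair x = (p1 ++ rev p2) ++ [seq (val c).+1 | c <- x.2],
    path ltn 0 (p1 ++ y :: p2), size p1 + size p2 = n - k.+1,
    size p2 = #|[set a in x.1 | a > thead x.2]| &
    perm_eq (word_of_pair x) (iota 1 n)].
Proof.
move=> px y; have eqx := perm_partial_word px.
set a := [seq _ | c <- enum x.1] in eqx.
have yNa : y \notin a.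
  have : uniq (a ++ [seq (val c).+1 | c <- x.2]) by rewrite (perm_uniq eqx) iota_uniq.
  by rewrite map_succ_thead cat_uniq => /and3P[_ /hasPn/(_ y (mem_head _ _))].
have eqa := perm_filter_neq yNa.
exists [seq z <- a | z < y], [seq z <- a | y < z]; split.
- by rewrite -catA.
- exact: path0_cat_filter (ltn0Sn _) (path0_map_succ_enum _).
- have sz2 : size [seq (val c).+1 | c <- x.2] = k.+1 by rewrite size_map size_tuple.
  have := perm_size eqx; rewrite size_cat sz2 size_iota -size_cat (perm_size eqa).
  by move=> <-; rewrite addnK.
- rewrite size_filter count_map cardE /enum_mem size_filter count_filter.
  by apply: eq_count => c; rewrite /= !inE andbC.
rewrite /word_of_pair -/a -/y catA; apply: perm_trans eqx; rewrite perm_cat2r.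
by apply: perm_trans eqa; rewrite perm_cat2l perm_rev.
Qed.

Lemma des_word_of_pair x : x \in partial_words n k.+1 ->
  des (word_of_pair x) = des_pair x.
Proof.
move=> /word_of_pairP[p1 [p2 [-> inc _ szp2 _]]]; rewrite /des_pair -szp2 addnC.
rewrite map_succ_thead des_cat; congr (_ + _).
set y := _.+1 in inc *; rewrite last_cat last_rev.
have incp : path ltn 0 (p1 ++ p2).
  by apply: subseq_path inc; [exact: ltn_trans | rewrite cat_subseq ?subseq_cons].
rewrite des_wave //; move: inc; rewrite cat_path => /andP[_ /andP[lty]].
(* If [p2] is nonempty, its first letter is the one before [y] and adds a descent to the
   [size p2 - 1] earlier ones; if it is empty, [last 0 p1 < y] and there is none. *)
by case: p2 {szp2 incp} => [|z p2 /andP[ltz _]] /=; move: lty; rewrite /=; lia.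
Qed.

End WordOfPair.

Lemma card_pair_srw (n k i : nat) : 0 < n -> k <= n - 1 ->
  #|[set x in partial_words n k.+1 | des_pair x == i]|
  = #|[set s : 'S_n | (des (word_of_perm s) == i)
                      && (n - k <= size (srw (word_of_perm s)))]|.
Proof.
move=> n_gt0 le_kn.
have /fin_all_exists[f fE] (x : {set 'I_n} * k.+1.-tuple 'I_n) :
    exists s : 'S_n, x \in partial_words n k.+1 -> word_of_perm s = word_of_pair x.
  have [/word_of_pairP[p1 [p2 [_ _ _ _ /word_of_perm_surj[s <-]]]]|_] := boolP (x \in _).
    by exists s.
  by exists 1%g.
have nkw (s : 'S_n) : 0 < n - k <= size (word_of_perm s).
  by rewrite size_word_of_perm; lia.
rewrite -(@card_in_imset _ _ f); last first.
  (* The last [k + 1] letters of the word give [rho], and [alpha_0] is its complement. *)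
  move=> x x'; rewrite in_set => /andP[px _]; rewrite in_set => /andP[px' _].
  move/(congr1 (@word_of_perm n)); rewrite !fE // => /eqP.
  have [p1 [p2 [-> _ sz _ _]]] := word_of_pairP px.
  have [p1' [p2' [-> _ sz' _ _]]] := word_of_pairP px'.
  rewrite eqseq_cat; last by rewrite !size_cat !size_rev sz sz'.
  have lt_inj : injective (fun c : 'I_n => (val c).+1) by move=> c d [] /val_inj.
  case/andP=> _ /eqP/(inj_map lt_inj)/val_inj.
  move: px px'; rewrite !inE; case: x x' {sz sz'} => [A t] [A' t'] /=.
  by move=> /andP[_ /eqP ->] /andP[_ /eqP ->] ->.
congr #|pred_of_set _|; apply/setP => s; rewrite in_set; apply/imsetP/andP.
  case=> x; rewrite in_set => /andP[px /eqP <-] ->.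
  rewrite fE // des_word_of_pair // eqxx; split=> //.
  have [p1 [p2 [Ex inc sz _ _]]] := word_of_pairP px.
  rewrite -(fE x px); apply/(leq_size_srwP (word_of_perm_uniq _) (word_of_perm_gt0 _) (nkw _)).
  exists p1, (val (thead x.2)).+1, p2; split=> //.
  rewrite fE // Ex map_succ_thead rev_cons -cats1 -[_ :: map _ _]cat1s !catA.
  by rewrite take_size_cat // !size_cat size_rev /=; lia.
case=> des_s; set w := word_of_perm s.
move/(leq_size_srwP (word_of_perm_uniq _) (word_of_perm_gt0 _) (nkw _)).
rewrite -/w => -[p1 [y [p2 [inc Dw]]]].
(* The preimage of [s]: [rho] consists of the last [k + 1] letters. It overlaps the prefix of length
   [n - k] in one letter, [y]. *)
pose r := drop (n - k.+1) [seq s j | j <- enum 'I_n].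
have szr : size r == k.+1.
  by rewrite size_drop size_map size_enum_ord; lia.
pose t := Tuple szr; pose x := ([set a | a \notin t], t).
have rw : [seq (val c).+1 | c <- t] = drop (n - k.+1) w.
  by rewrite /= map_drop -map_comp.
have Ew : w = (p1 ++ rev p2) ++ y :: drop (n - k) w.
  by rewrite -{1}(cat_take_drop (n - k) w) Dw rev_cons -cats1 -!catA.
have szp : size (p1 ++ rev p2) = n - k.+1.
  have := congr1 size Dw; rewrite size_takel; last by case/andP: (nkw s).
  by rewrite rev_cons !size_cat size_rcons size_rev; lia.
have rw' : [seq (val c).+1 | c <- t] = y :: drop (n - k) w.
  by rewrite rw {1}Ew drop_size_cat.
have px : x \in partial_words n k.+1.
  rewrite inE /= eqxx andbT drop_uniq // map_inj_uniq ?enum_uniq //; exact: perm_inj.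
have Dy : (val (thead t)).+1 = y.
  by have := map_succ_thead x; rewrite /= in rw' *; rewrite rw' => -[].
have Da : [seq (val c).+1 | c <- enum x.1] = p1 ++ p2.
  have incp : path ltn 0 (p1 ++ p2).
    by apply: subseq_path inc; [exact: ltn_trans | rewrite cat_subseq ?subseq_cons].
  (* Both sides are increasing, and both become permutations of [1, ..., n] when the letters of
     [rho] are appended. *)
  apply: (irr_sorted_eq ltn_trans ltnn (path_sorted (path0_map_succ_enum _)) (path_sorted incp)).
  apply: perm_mem; rewrite -(perm_cat2r [seq (val c).+1 | c <- t]).
  rewrite (perm_trans (perm_partial_word px)) // perm_sym.
  apply: perm_trans (perm_word_of_perm s); rewrite -/w [in X in perm_eq _ X]Ew rw' perm_cat2r.
  by rewrite perm_cat2l perm_sym perm_rev.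
have Dx : word_of_pair x = w.
  have [f1 f2] := path0_filter_cat inc.
  by rewrite /word_of_pair Da Dy f1 f2 rw' [RHS]Ew catA.
exists x; last by apply: word_of_perm_inj; rewrite fE.
by rewrite in_set px -des_word_of_pair // Dx.
Qed.

Theorem theorem6p14 (n k i : nat) (hn : 1 <= n) (hk : k <= n - 1) (hi : 0 < i) :
  [/\ #|[set x in partial_words n k.+1 | des_pair x == i]|
      = #|[set s : 'S_n | (des (word_of_perm s) == i)
                          && (n - k <= size (srw (word_of_perm s)))]|,
      #|[set x in partial_words n k.+1 | des_pair x == i]|
      = #|[set s : 'S_n | (des (word_of_perm s) == i)
                          && (n - k <= size (sw (word_of_perm s)))]|
    & #|[set x in partial_words n k.+1 | des_pair x == i]|
      = #|[set s : 'S_n | (lec (word_of_perm s) == i)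
                          && (n - k <= size (rightmost_hook (word_of_perm s)))]|].
Proof.
have eq12 := card_pair_srw i hn hk.
have eq24 := card_wave_hook n i (n - k) wave_insertion_srw.
have eq34 := card_wave_hook n i (n - k) wave_insertion_sw.
by split; rewrite // eq12 eq24 ?eq34.
Qed.
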